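(* There exists a function $f:\mathbb{N}\to\mathbb{N}$ such that for every integer $k\geq 1$, every positive integer $m$ and every finite group $G$ in which the set of $\gamma_k^*$-commutators has size $m$, one has $|\gamma_k^*(G)|\leq f(m)$. (That is, $|\gamma_k^*(G)|$ is $m$-bounded, with a bound depending only on $m$ and not on $k$ or $G$.)
   Context: Let $G$ be a finite group; $|a|$ denotes the order of the element $a$ and $[a,b]$ is the commutator $a^{-1}b^{-1}ab$. The $\gamma_k^*$-commutators of $G$ are defined recursively. Every element of $G$ is a $\gamma_1^*$-commutator. For $k\geq 2$, let $X$ be the set of all elements of $G$ that are powers of $\gamma_{k-1}^*$-commutators; an element $g\in G$ is a $\gamma_k^*$-commutator if there exist $a\in X$ and $b\in G$ such that $g=[a,b]$ and $(|a|,|b|)=1$. The subgroup of $G$ generated by all $\gamma_k^*$-commutators is denoted by $\gamma_k^*(G)$. The term ''$m$-bounded'' means bounded by a function of $m$ only. *)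

(* Defs.v *)
From mathcomp Require Import all_boot all_fingroup.

Set Implicit Arguments.
Unset Strict Implicit.
Unset Printing Implicit Defensive.

Local Open Scope group_scope.

Definition powers (gT : finGroupType) (S : {set gT}) : {set gT} :=
  \bigcup_(x in S) <[x]>.

Definition coprime_comms (gT : finGroupType) (X B : {set gT}) : {set gT} :=
  [set [~ a, b] | a in X, b in B & coprime #[a] #[b]].

(* Meaningful for k >= 1 only: k = 0 gives the same set as k = 1. *)
Definition gamma_star_comms (k : nat) (gT : finGroupType) (G : {set gT}) :
    {set gT} :=
  iter k.-1 (fun S => coprime_comms (powers S) G) G.

Definition gamma_star (k : nat) (gT : finGroupType) (G : {set gT}) :
    {set gT} :=
  <<gamma_star_comms k G>>.

(* Main.v *)
Require Import Defs.
From mathcomp Require Import all_boot all_fingroup.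
From mathcomp Require Import ssralg finalg all_solvable.

(* Let X be the set of gamma_k^*-commutators, K the subgroup it generates and
   m = #|X|, with k >= 2.  If X is trivial then G is nilpotent (induction on k:
   the p-parts of gamma_{k-1}^*-commutators centralise all p'-elements, hence
   are hypercentral), so G / K is always nilpotent.
   If K is abelian, P is its Sylow p-subgroup and h is a p'-element, then
   [P, h] = [P, h, h] consists of gamma_k^*-commutators, so its elements have
   order at most m.  Modulo the normal subgroup L generated by the elements of X
   of order at most m, p-elements of K commute with p'-elements of G, so G / L is
   nilpotent and K = L.  Dietzmann's lemma then bounds #|K|.
   In general this bounds #|K : K'|, while #|K : 'Z(K)| <= m ^ m since K acts
   on X with kernel 'Z(K), and the transfer into 'Z(K) bounds the exponent of
   K' :&: 'Z(K).  So the exponent of K is bounded, and Dietzmann's lemma applies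
   again. *)

Set Implicit Arguments.
Unset Strict Implicit.
Unset Printing Implicit Defensive.

Local Open Scope group_scope.

(** * Quotients and conjugates of gamma_k^*-commutators *)

Lemma powers_quotient (gT : finGroupType) (N : {group gT}) (S : {set gT}) :
  S \subset 'N(N) -> powers (S / N) = powers S / N.
Proof.
move=> nNS; apply/setP=> y.
apply/bigcupP/morphimP=> [[_ /morphimP[x Nx Sx ->]]|[x Nx]].
  case/cycleP=> i ->; exists (x ^+ i); rewrite ?groupX ?morphX //.
  by apply/bigcupP; exists x; rewrite ?mem_cycle.
case/bigcupP=> s Ss /cycleP[i def_x] ->; have Ns := subsetP nNS s Ss.
exists (coset N s); first exact: mem_morphim.
by rewrite def_x morphX ?mem_cycle.
Qed.

(* A pair of coprime elements of the quotient lifts to a pair of coprime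
   elements: replace arbitrary lifts [a], [b] by their [pi]-part and
   [pi']-part, where [pi] is the set of primes dividing the order of the
   image of [a]. *)
Lemma coprime_comms_quotient (gT : finGroupType) (N : {group gT})
    (S B : {set gT}) :
  S \subset 'N(N) -> B \subset 'N(N) -> powers S \subset S ->
  powers B \subset B ->
  coprime_comms (S / N) (B / N) = coprime_comms S B / N.
Proof.
move=> nNS nNB pS pB; apply/setP=> y; apply/imset2P/morphimP.
  case=> _ yb /morphimP[a Na Sa ->]; rewrite inE.
  case/andP=> [/morphimP[b Nb Bb ->] co ->].
  pose pi := \pi(#[coset N a]).
  have S1: a.`_pi \in S.
    by apply: (subsetP pS); apply/bigcupP; exists a; rewrite ?cycle_constt.
  have B1: b.`_pi^' \in B.
    by apply: (subsetP pB); apply/bigcupP; exists b; rewrite ?cycle_constt.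
  have co1: coprime #[a.`_pi] #[b.`_pi^'].
    exact: pnat_coprime (p_elt_constt _ _) (p_elt_constt _ _).
  have Na1 := subsetP nNS _ S1; have Nb1 := subsetP nNB _ B1.
  exists [~ a.`_pi, b.`_pi^']; rewrite ?groupR //.
    by apply/imset2P; exists a.`_pi b.`_pi^'; rewrite // inE B1.
  rewrite morphR // !morph_constt // !constt_p_elt //.
    by rewrite /p_elt -coprime_pi'.
  exact: pnat_pi.
case=> _ _ /imset2P[a b Sa /[!inE] /andP[Bb co] ->] ->.
have Na := subsetP nNS _ Sa; have Nb := subsetP nNB _ Bb.
exists (coset N a) (coset N b); rewrite ?mem_morphim ?morphR // inE mem_morphim //.
by apply: coprime_dvdl (morph_order _ Na) (coprime_dvdr (morph_order _ Nb) co).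
Qed.

Lemma powers_idem (gT : finGroupType) (S : {set gT}) :
  powers (powers S) \subset powers S.
Proof.
apply/bigcupsP=> x /bigcupP[s Ss sx]; apply: subset_trans (bigcup_sup s Ss).
by rewrite cycle_subG.
Qed.

Lemma powers_sub (gT : finGroupType) (G : {group gT}) (S : {set gT}) :
  S \subset G -> powers S \subset G.
Proof.
by move=> sSG; apply/bigcupsP=> x Sx; rewrite cycle_subG (subsetP sSG).
Qed.

Lemma sub_powers (gT : finGroupType) (S : {set gT}) : S \subset powers S.
Proof. by apply/subsetP=> x Sx; apply/bigcupP; exists x; rewrite ?cycle_id. Qed.

Lemma gamma_star_comms_sub (k : nat) (gT : finGroupType) (G : {group gT}) :
  gamma_star_comms k G \subset G.
Proof.
rewrite /gamma_star_comms; elim: k.-1 => //= n IHn.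
apply/subsetP=> _ /imset2P[a b Sa /[!inE] /andP[Gb _] ->].
by rewrite groupR // (subsetP (powers_sub IHn)).
Qed.

Lemma gamma_star_comms_quotient (k : nat) (gT : finGroupType)
    (G N : {group gT}) :
  N <| G -> gamma_star_comms k (G / N) = gamma_star_comms k G / N.
Proof.
case/andP=> _ nNG; rewrite /gamma_star_comms.
elim: k.-1 => //= n ->.
have sXG := gamma_star_comms_sub n.+1 G; rewrite /gamma_star_comms /= in sXG.
rewrite powers_quotient ?(subset_trans sXG) //.
rewrite coprime_comms_quotient ?powers_idem //; last exact: powers_sub.
exact: subset_trans (powers_sub sXG) nNG.
Qed.

Lemma gamma_star_comms_norm (k : nat) (gT : finGroupType) (G : {group gT}) :
  G \subset 'N(gamma_star_comms k G).
Proof.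
rewrite /gamma_star_comms; elim: k.-1 => [|n IHn] /=; first exact: normG.
apply/subsetP=> g Gg; rewrite inE.
apply/subsetP=> _ /imsetP[_ /imset2P[a b Sa /[!inE] /andP[Gb co] ->] ->].
have{Sa} /bigcupP[s Ss sa] := Sa.
rewrite conjRg; apply/imset2P; exists (a ^ g) (b ^ g) => //.
  apply/bigcupP; exists (s ^ g); last by rewrite cycleJ memJ_conjg.
  by rewrite memJ_norm // (subsetP IHn).
by rewrite !inE groupJ //= !orderJ.
Qed.

Lemma gamma_star_normal (k : nat) (gT : finGroupType) (G : {group gT}) :
  <<gamma_star_comms k G>> <| G.
Proof.
by rewrite /normal gen_subG gamma_star_comms_sub norms_gen // gamma_star_comms_norm.
Qed.

(** * A nilpotency criterion through the hypercentre *)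

(* The elements of [G] centralising all [q']-elements form a normal subgroup,
   which meets a Sylow [q]-subgroup [Q] containing [a] in a normal subgroup of
   [Q]; if nontrivial, this subgroup meets ['Z(Q)], and the intersection is
   central in [G]. *)
Lemma center1_cent_p'elt (gT : finGroupType) (G : {group gT}) (q : nat) (a : gT) :
  prime q -> 'Z(G) = 1 -> a \in G -> q.-elt a ->
  (forall y, y \in G -> q^'.-elt y -> commute a y) -> a = 1.
Proof.
move=> pr_q Z1 Ga qa cay.
have [Q sylQ saQ]: {Q : {group gT} | q.-Sylow(G) Q & <[a]> \subset Q}.
  by apply: Sylow_superset; rewrite ?cycle_subG.
pose Y := [set y in G | q^'.-elt y]; pose C := 'C_G(Y)%G.
have nYG: G \subset 'N(Y).
  apply/subsetP=> g Gg; rewrite inE.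
  apply/subsetP=> _ /imsetP[y /[!inE] /andP[Gy qy] ->].
  by rewrite groupJ // p_eltJ.
have Ca: a \in C.
  by rewrite inE Ga; apply/centP=> y /[!inE] /andP[]; apply: cay.
have sQG := pHall_sub sylQ.
have nCQ: C :&: Q <| Q.
  rewrite setIC; apply: (normalGI sQG).
  by rewrite /normal subsetIl normsI ?normG ?norms_cent.
suff CQ1: C :&: Q :=: 1.
  by apply/set1gP; rewrite -CQ1 inE Ca -cycle_subG.
apply: TI_center_nil (pgroup_nil (pHall_pgroup sylQ)) nCQ _.
apply/trivgP; rewrite -Z1; apply/subsetP=> z.
case/setIP=> [/setIP[/setIP[Gz Cz] Qz] /setIP[_ zQ]].
rewrite inE Gz -sub_cent1; apply/setIidPl.
apply/eqP; rewrite eqEcard subsetIl dvdn_leq //.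
apply/dvdn_partP=> // p _.
(* For [p = q] the subgroup [Q] works because [z] lies in its centre; for other [p], every element
   of [P] is a [q^']-element. *)
have sub: exists2 P : {group gT}, p.-Sylow(G) P & P \subset 'C_G[z].
  have [-> | neq] := eqVneq p q.
    by exists Q; rewrite // subsetI sQG sub_cent1.
  have [P sylP] := Sylow_exists p G; exists P => //.
  rewrite subsetI (pHall_sub sylP) sub_cent1.
  suff sPY: P \subset Y by rewrite (subsetP (centS sPY)).
  apply/subsetP=> y Py.
  rewrite inE (subsetP (pHall_sub sylP)) //.
  apply: sub_in_pnat (mem_p_elt (pHall_pgroup sylP) Py) => r _ /eqP ->.
  by rewrite !inE.
have [P sylP sPC] := sub.
by rewrite -(card_Hall sylP) cardSg.
Qed.

(** If the upper central series grew strictly at each of its first [#|G|] steps, its term of index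
    [#|G|] would have more than [#|G|] elements. *)
Lemma hypercenter_quotient_center1 (gT : finGroupType) (G : {group gT}) :
  exists n, 'Z(G / 'Z_n(G)) = 1.
Proof.
suff /existsP[n /eqP eqn]: [exists n : 'I_#|G|, 'Z_n.+1(G) == 'Z_n(G)].
  by exists n; rewrite -ucn_central eqn trivg_quotient.
apply: contraT; rewrite negb_exists => /forallP neqZ.
suff: #|G| < #|'Z_(#|G|)(G)| by rewrite ltnNge subset_leq_card ?ucn_sub.
suff: forall n, n <= #|G| -> n < #|'Z_n(G)| by apply.
elim=> [|n IHn] lt_n; first by rewrite cardG_gt0.
apply: leq_ltn_trans (IHn (ltnW lt_n)) (proper_card _).
by rewrite properEneq ucn_subS andbT eq_sym; apply: (neqZ (Ordinal lt_n)).
Qed.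

(** Modulo a term ['Z_n(G)] with centreless quotient, every primary part of an element of [S]
    vanishes, so [<<S>>] is hypercentral. Then [G / 'Z_n(G)] is an image of [G / <<S>>], hence
    nilpotent without centre, hence trivial. *)
Lemma coprime_cent_gen_nilpotent (gT : finGroupType) (G : {group gT})
    (S : {set gT}) :
    S \subset G -> <<S>> <| G -> nilpotent (G / <<S>>) ->
    (forall q s y, prime q -> s \in S -> y \in G -> q^'.-elt y -> commute s.`_q y) ->
  nilpotent G.
Proof.
move=> sSG nSG nilGS comm; have [n Z1] := hypercenter_quotient_center1 G.
have nZ: G \subset 'N('Z_n(G)) := ucn_norm n G.
have sSZ: <<S>> \subset 'Z_n(G).
  rewrite gen_subG; apply/subsetP=> s Ss; have Gs := subsetP sSG s Ss.
  have Ns := subsetP nZ s Gs.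
  apply: coset_idr => //; rewrite -[coset _ s]prod_constt.
  apply: big1_seq => q _.
  have [pr_q|npr_q] := boolP (prime q); last first.
    by apply/eqP; rewrite -order_eq1 order_constt p_part lognE (negPf npr_q).
  apply: (center1_cent_p'elt pr_q Z1); rewrite ?p_elt_constt //.
    by rewrite groupX // mem_quotient.
  move=> _ /morphimP[y Ny Gy ->] qy.
  rewrite -(constt_p_elt qy) -!morph_constt //; rewrite /commute -!morphM ?groupX //.
  by rewrite (comm q s y.`_q^') ?p_elt_constt ?groupX.
have: nilpotent (G / 'Z_n(G)).
  have /homgP[f <-] := homg_quotientS (normal_norm nSG) nZ sSZ.
  exact: morphim_nil.
move/center_nil_eq1; rewrite Z1 eqxx => /esym/eqP/trivgP.
rewrite quotient_sub1 // => sGZ; apply/ucnP; exists n.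
by apply/eqP; rewrite eqEsubset ucn_sub.
Qed.

(** * Dietzmann's lemma *)

(* Moving the occurrences of [s] to the front conjugates the letters they pass. *)
Lemma word_extract (gT : finGroupType) (S : {set gT}) (s : gT) (j : nat)
    (w : seq gT) :
  {in S, forall x, x ^ s \in S} -> {subset w <= S} -> j <= count_mem s w ->
  exists w' : seq gT, [/\ {subset w' <= S}, size w = j + size w'
    & \prod_(x <- w) x = s ^+ j * \prod_(x <- w') x].
Proof.
move=> conjS; have conjX i x: x \in S -> x ^ (s ^+ i) \in S.
  move=> Sx; elim: i => [|i IHi]; first by rewrite conjg1.
  by rewrite expgSr conjgM conjS.
elim: w j => [|y w IHw] j sub /=.
  by rewrite leqn0 => /eqP->; exists [::]; rewrite expg0 mul1g.
have Sy: y \in S by rewrite sub ?mem_head.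
have sub': {subset w <= S} by move=> x wx; rewrite sub // inE wx orbT.
case: j => [|j]; first by exists (y :: w); split; rewrite // expg0 mul1g.
have [-> | neq] := eqVneq y s; rewrite ?add1n ?add0n => lej.
  have [w' [Sw' sz pr]] := IHw j sub' lej.
  by exists w'; split=> //; [rewrite sz addSn | rewrite big_cons pr expgS mulgA].
have [w' [Sw' sz pr]] := IHw j.+1 sub' lej.
exists (y ^ (s ^+ j.+1) :: w'); split.
- by move=> x /[!inE] /orP[/eqP-> | /Sw' //]; apply: conjX.
- by rewrite /= sz addnS.
by rewrite !big_cons pr conjgE !mulgA mulgV mul1g.
Qed.

Lemma sum_count_mem (T : finType) (S : {set T}) (w : seq T) :
  {subset w <= S} -> \sum_(s in S) count_mem s w = size w.
Proof.
elim: w => [|y w IHw] sub; first by rewrite big1.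
rewrite /= big_split /= IHw => [|x wx]; last by rewrite sub // inE wx orbT.
rewrite (bigD1 y) ?sub ?mem_head //= eqxx big1 ?addn0 // => x /andP[_ neq].
by rewrite eq_sym (negPf neq).
Qed.

(** By pigeonhole, a word longer than [#|S| * e] contains some [s] at least [#[s]] times; collecting
    [#[s]] copies in front cancels them. *)
Lemma word_shorten (gT : finGroupType) (S : {set gT}) (e : nat) (w : seq gT) :
    {in S &, forall x y, x ^ y \in S} -> {in S, forall x, #[x] <= e} ->
    {subset w <= S} ->
  exists w' : seq gT, [/\ {subset w' <= S}, size w' <= #|S| * e
    & \prod_(x <- w) x = \prod_(x <- w') x].
Proof.
move=> conjS ordS; have [n] := ubnP (size w); elim: n w => // n IHn w ltn sub.
have [le|gt] := leqP (size w) (#|S| * e); first by exists w.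
have [s Ss les]: exists2 s, s \in S & #[s] <= count_mem s w.
  apply/exists_inP; apply: contraLR gt.
  rewrite negb_exists_in -leqNgt => /forall_inP no.
  rewrite -(sum_count_mem sub) -sum_nat_const; apply: leq_sum => s Ss.
  by apply: ltnW; apply: leq_trans (ordS s Ss); rewrite ltnNge no.
have conjs: {in S, forall x, x ^ s \in S} by move=> x Sx; apply: conjS.
have [w' [Sw' sz pr]] := word_extract conjs sub les.
have [|w2 [Sw2 sz2 pr2]] := IHn w' _ Sw'.
  by rewrite -ltnS (leq_ltn_trans _ ltn) // sz -add1n leq_add2r order_gt0.
by exists w2; split=> //; rewrite pr expg_order mul1g.
Qed.

Lemma card_expgs (gT : finGroupType) (A : {set gT}) (n : nat) :
  #|A ^+ n| <= #|A| ^ n.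
Proof.
elim: n => [|n IHn]; first by rewrite expg0 expn0 cards1.
rewrite expgS expnS (leq_trans _ (leq_mul (leqnn _) IHn)) //.
by rewrite -cardsX [A * _]curry_imset2X leq_imset_card.
Qed.

Lemma expgs_sub (gT : finGroupType) (A : {set gT}) (n m : nat) :
  1 \in A -> n <= m -> A ^+ n \subset A ^+ m.
Proof.
move=> A1 le; rewrite -(subnK le) expgD -{1}[A ^+ n]mul1g mulSg // sub1set.
elim: (m - n) => [|i IHi]; first by rewrite expg0 inE.
by rewrite expgS; apply/imset2P; exists 1 1; rewrite ?mulg1.
Qed.

Lemma leq_exp2 (a b n : nat) : a <= b -> a ^ n <= b ^ n.
Proof. by case: n => // n; rewrite leq_exp2r. Qed.

(** Shortened words, padded with 1, all lie in the power of [1 |: S] of exponent [#|S| * e]. *)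
Lemma card_gen_leq (gT : finGroupType) (S : {set gT}) (e : nat) :
    {in S &, forall x y, x ^ y \in S} -> {in S, forall x, #[x] <= e} ->
  #|<<S>>| <= #|S|.+1 ^ (#|S| * e).
Proof.
move=> conjS ordS; have c1S: #|1 |: S| <= #|S|.+1.
  by rewrite cardsU1 -add1n leq_add2r leq_b1.
apply: (leq_trans _ (leq_trans (card_expgs _ (#|S| * e)) (leq_exp2 _ c1S))).
apply: subset_leq_card; apply/subsetP=> x /gen_prodgP[n [c Sc ->]].
pose w := [seq c i | i <- index_enum 'I_n].
have sub: {subset w <= S} by move=> _ /mapP[i _ ->].
have -> : \prod_(i < n) c i = \prod_(x <- w) x by rewrite big_map.
have [w' [Sw' sz ->]] := word_shorten conjS ordS sub.
apply: (subsetP (expgs_sub (setU11 _ _) sz)).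
elim: w' Sw' {sz} => [|y w' IHw] sub'; first by rewrite big_nil expg0 inE.
rewrite big_cons expgS mem_mulg ?IHw //; last first.
  by move=> z w'z; rewrite sub' // inE w'z orbT.
by rewrite inE sub' ?mem_head ?orbT.
Qed.

(** * Centraliser index and transfer into the centre *)

(** A coset of the centraliser is determined by the map from [S] to [S] that its elements induce by
    conjugation. *)
Lemma index_cent_leq (gT : finGroupType) (G : {group gT}) (S : {set gT}) :
  G \subset 'N(S) -> #|G : 'C_G(S)| <= #|S| ^ #|S|.
Proof.
(* The value 1 outside [S] makes [f Hx] a function supported on [S], as [card_pffun_on] counts
   them. *)
move=> nSG; pose f (Hx : {set gT}) := [ffun x => if x \in S then x ^ repr Hx else 1].
rewrite -(card_pffun_on 1) /indexg -(card_in_imset (f := f)).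
  apply: subset_leq_card; apply/subsetP=> _ /imsetP[_ /rcosetsP[g Gg ->] ->].
  have Gr: repr ('C_G(S) :* g) \in G.
    by case: repr_rcosetP => h /setIP[Gh _]; rewrite groupM.
  apply/pffun_onP; split=> [|_ /imageP[x Sx ->]].
    by apply/subsetP=> x; apply: contraR => nSx; rewrite ffunE (negPf nSx).
  by rewrite ffunE; move: (Sx) => ->; rewrite memJ_norm // (subsetP nSG).
move=> _ _ /rcosetsP[g Gg ->] /rcosetsP[h Gh ->] /ffunP eqf.
have rep u: u \in G -> exists2 v,
    v \in G & 'C_G(S) :* u = 'C_G(S) :* v /\ repr ('C_G(S) :* u) = v.
  move=> Gu; exists (repr ('C_G(S) :* u)); last by rewrite rcoset_repr.
  by case: repr_rcosetP => c /setIP[Gc _]; rewrite groupM.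
have [g1 Gg1 [eqg rg]] := rep g Gg; have [h1 Gh1 [eqh rh]] := rep h Gh.
rewrite eqg eqh; apply/rcoset_eqP; rewrite mem_rcoset inE groupM ?groupV //=.
apply/centP=> x Sx; apply/commute_sym/commgP/conjg_fixP.
have:= eqf x; rewrite !ffunE Sx rg rh conjgM => ->.
by rewrite conjgK.
Qed.

(* Transfer into the centre is [z |-> z ^+ #|G : 'Z(G)|] on central elements,
   and kills the derived subgroup since its target is abelian. *)
Lemma expg_index_center_der1 (gT : finGroupType) (G : {group gT}) (z : gT) :
  z \in 'Z(G) -> z \in G^`(1) -> z ^+ #|G : 'Z(G)| = 1.
Proof.
move=> Zz G'z.
have abZ : abelian (idm 'Z(G) @* 'Z(G)) by rewrite morphim_idm ?center_abelian.
have Az : z \in (idm 'Z(G) @* 'Z(G))%G by rewrite /= morphim_idm.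
pose tau := transfer_morphism G abZ.
have: tau z \in tau @* G^`(1) by rewrite mem_morphim ?(subsetP (der_sub 1 G)).
rewrite morphim_der // (derG1P (FinRing.zmod_abelian _)) => /set1gP.
have [Gz cGz] := setIP Zz.
rewrite /tau /= /transfer (eq_bigr (fun _ => FiniteModule.fmod abZ z)).
  rewrite GRing.sumr_const => /(congr1 val).
  by rewrite FiniteModule.fmvalZ /= FiniteModule.fmodK.
move=> _ /rcosetsP[x Gx ->].
rewrite -rcosetM -(centP cGz x Gx) rcosetM (rcoset_id Zz).
set r := repr _; have Gr: r \in G.
  rewrite /r; case: repr_rcosetP => h Zh.
  by rewrite groupM // (subsetP (center_sub G)).
by rewrite -(centP cGz r Gr) mulgK.
Qed.

(** * Trivial gamma_k^*-commutators and nilpotency *)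

Lemma gamma_star_comms_quotient_gen (k : nat) (gT : finGroupType)
    (G : {group gT}) (K := <<gamma_star_comms k G>>) :
  gamma_star_comms k (G / K) \subset [1 coset_of K].
Proof.
have nKG := gamma_star_normal k G.
rewrite gamma_star_comms_quotient // quotient_sub1 ?subset_gen //.
exact: subset_trans (gamma_star_comms_sub _ _) (normal_norm nKG).
Qed.

Lemma gamma_star_comms1_nilpotent (k : nat) (gT : finGroupType)
    (G : {group gT}) :
  gamma_star_comms k.+1 G \subset [1 gT] -> nilpotent G.
Proof.
elim: k gT G => [|k IHk] gT G X1.
  by apply: nilpotentS X1 (nilpotent1 _).
have nXG := gamma_star_normal k.+1 G.
apply: (coprime_cent_gen_nilpotent (gamma_star_comms_sub k.+1 G) nXG).
  exact: IHk (gamma_star_comms_quotient_gen _ _).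
move=> q s y pr_q Xs Gy qy; apply/commgP/eqP/set1gP/(subsetP X1).
apply/imset2P; exists s.`_q y; rewrite ?inE ?Gy //=.
  by apply/bigcupP; exists s; rewrite ?cycle_constt.
exact: pnat_coprime (p_elt_constt _ _) qy.
Qed.

Lemma nilpotent_gamma_star_comms1 (k : nat) (gT : finGroupType)
    (G : {group gT}) :
  nilpotent G -> gamma_star_comms k.+2 G \subset [1 gT].
Proof.
move=> nilG; apply/subsetP=> _ /imset2P[a b Pa /[!inE] /andP[Gb co] ->].
have Ga := subsetP (powers_sub (gamma_star_comms_sub k.+1 G)) a Pa.
have /centsP cab: <[a]> \subset 'C(<[b]>).
  by apply: (sub_nilpotent_cent2 nilG); rewrite ?cycle_subG // coprime_sym.
by apply/commgP/cab; rewrite cycle_id.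
Qed.

(** * The case of abelian [<<X>>] *)

(** Each element of [R] is some [[~ y, h]] with [y] in [R]; inductively [y] is a commutator of the
    previous level, and its order is coprime to that of [h]. *)
Lemma sub_gamma_star_comms (k : nat) (gT : finGroupType) (G R : {group gT})
    (pi : nat_pred) (h : gT) :
    R \subset G -> pi.-group R -> h \in G -> pi^'.-elt h ->
    R \subset [set [~ y, h] | y in R] ->
  R \subset gamma_star_comms k G.
Proof.
rewrite /gamma_star_comms => sRG piR Gh pih sR.
elim: k.-1 => // n IHn; apply: subset_trans sR _.
apply/subsetP=> _ /imsetP[y Ry ->]; apply/imset2P; exists y h => //.
  by apply: (subsetP (sub_powers _)); apply: (subsetP IHn).
by rewrite inE Gh (pnat_coprime (mem_p_elt piR Ry) pih).
Qed.

(** By coprime action [h] fixes only 1 in [[~: P, <[h]>]], so the map sending [y] to [[~ y, h]] is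
    injective from this finite subgroup to itself, hence onto. *)
Lemma commg_coprime_surj (gT : finGroupType) (P : {group gT}) (h : gT) :
    abelian P -> h \in 'N(P) -> coprime #|P| #[h] ->
  [~: P, <[h]>] \subset [set [~ y, h] | y in [~: P, <[h]>]].
Proof.
move=> abP nPh co; have nPH: <[h]> \subset 'N(P) by rewrite cycle_subG.
set R := [~: P, <[h]>]; have sRP: R \subset P by rewrite commg_subl.
have nRh: h \in 'N(R).
  by rewrite -cycle_subG; apply: commg_normr.
suff -> : [set [~ y, h] | y in R] = R by exact: subxx.
apply/eqP; rewrite eqEcard; apply/andP; split.
  apply/subsetP=> _ /imsetP[y Ry ->].
  by rewrite commgEl groupM ?groupV ?memJ_norm.
rewrite card_in_imset // => y z Ry Rz eqyz.
have /set1gP: y * z^-1 \in [1 gT].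
  rewrite -(coprime_abel_cent_TI nPH co abP) inE groupM ?groupV //=.
  rewrite cent_cycle; apply/cent1P/commgP/conjg_fixP.
  by rewrite conjMg conjVg !conjg_mulR eqyz invMg mulgA mulgK.
by move/(canRL (mulgKV _)); rewrite mul1g.
Qed.

(* In an abelian group, coprimality gives [P, h] = [P, h, h], so [P, h] consists
   of gamma_k^*-commutators for every k. *)
Lemma gamma_star_comms_coprime (k : nat) (gT : finGroupType) (G P : {group gT})
    (pi : nat_pred) (x h : gT) :
    P <| G -> abelian P -> pi.-group P -> x \in P -> h \in G -> pi^'.-elt h ->
  [~ x, h] \in gamma_star_comms k G /\ #[[~ x, h]] <= #|gamma_star_comms k G|.
Proof.
move=> /andP[sPG nPG] abP piP Px Gh pih; have nPh := subsetP nPG h Gh.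
have co: coprime #|P| #[h] by apply: pnat_coprime piP pih.
have sRP: [~: P, <[h]>] \subset P by rewrite commg_subl cycle_subG.
have Rxh: [~ x, h] \in [~: P, <[h]>] by rewrite mem_commg ?cycle_id.
have sRX: [~: P, <[h]>] \subset gamma_star_comms k G.
  apply: sub_gamma_star_comms (subset_trans sRP sPG) (pgroupS sRP piP) Gh pih _.
  exact: commg_coprime_surj.
split; first exact: (subsetP sRX).
apply: leq_trans (subset_leq_card sRX).
by rewrite orderE subset_leq_card // cycle_subG.
Qed.

Lemma norm_order_leq (gT : finGroupType) (A S : {set gT}) (e : nat) :
  A \subset 'N(S) -> A \subset 'N([set x in S | #[x] <= e]).
Proof.
move=> nSA; apply/subsetP=> g Ag; rewrite inE.
apply/subsetP=> _ /imsetP[x /[!inE] /andP[Sx ox] ->].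
by rewrite orderJ ox memJ_norm ?Sx // (subsetP nSA).
Qed.

Lemma gamma_star_abelian_gen (k : nat) (gT : finGroupType) (G : {group gT})
    (X := gamma_star_comms k.+2 G) :
  abelian <<X>> -> X \subset <<[set x in X | #[x] <= #|X|]>>.
Proof.
move=> abX; set T := [set x in X | _].
have nXG: <<X>> <| G := gamma_star_normal k.+2 G.
have sTX: <<T>> \subset <<X>> by apply/genS/subsetP=> x /[!inE] /andP[].
have nTG: <<T>> <| G.
  rewrite /normal (subset_trans sTX (normal_sub nXG)) norms_gen //.
  by rewrite norm_order_leq ?gamma_star_comms_norm.
have nilGX: nilpotent (G / <<X>>).
  exact: gamma_star_comms1_nilpotent (gamma_star_comms_quotient_gen _ _).
have nTG' := normal_norm nTG.
(* A nilpotent quotient has only trivial commutators of this kind, which forces [X] into [<<T>>]. *)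
suff nilGT: nilpotent (G / <<T>>).
  have := nilpotent_gamma_star_comms1 k nilGT; rewrite gamma_star_comms_quotient //.
  by rewrite quotient_sub1 // (subset_trans (gamma_star_comms_sub _ _)).
apply: (@coprime_cent_gen_nilpotent _ _ (<<X>> / <<T>>)).
- by rewrite quotientS // normal_sub.
- by rewrite genGid quotient_normal.
- by rewrite genGid (isog_nil (third_isog sTX nTG nXG)).
move=> q _ _ pr_q /morphimP[x Nx Xx ->] /morphimP[h Nh Gh ->] qh.
(* Lifting to [x.]_q[and]h.[_q^'] puts their commutator in [T]. *)
rewrite -(constt_p_elt qh) -!morph_constt //; apply/commgP.
rewrite -morphR ?groupX //; apply/eqP/coset_id; apply: mem_gen.
have OX: 'O_q(<<X>>) <| G by apply: gFnormal_trans.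
have [||||| Xxh oxh] := @gamma_star_comms_coprime k.+2 _ _ _ q x.`_q h.`_q^' OX.
- exact: abelianS (pcore_sub _ _) abX.
- exact: pcore_pgroup.
- rewrite (mem_normal_Hall (nilpotent_pcore_Hall q (abelian_nil abX))) //.
  + exact: p_elt_constt.
  + exact: pcore_normal.
  + exact: groupX.
- exact: groupX.
- exact: p_elt_constt.
by rewrite inE Xxh.
Qed.

Lemma gamma_star_abelian_leq (k : nat) (gT : finGroupType) (G : {group gT})
    (X := gamma_star_comms k.+2 G) :
  abelian <<X>> -> #|<<X>>| <= #|X|.+1 ^ (#|X| * #|X|).
Proof.
move=> abX; set T := [set x in X | #[x] <= #|X|].
have sTX: #|T| <= #|X| by apply/subset_leq_card/subsetP=> x /[!inE] /andP[].
have X_T: <<X>> \subset <<T>> by rewrite gen_subG gamma_star_abelian_gen.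
apply: leq_trans (subset_leq_card X_T) _.
apply: leq_trans (card_gen_leq (e := #|X|) _ _) _.
- move=> x y Tx Ty; rewrite memJ_norm //.
  have nTG := norm_order_leq #|X| (gamma_star_comms_norm k.+2 G).
  apply: (subsetP nTG); apply: (subsetP (gamma_star_comms_sub k.+2 G)).
  by move: Ty; rewrite inE => /andP[].
- by move=> x /[!inE] /andP[].
apply: leq_trans (leq_exp2 _ (sTX : #|T| < #|X|.+1)) _.
by apply: leq_pexp2l; rewrite // leq_mul2r sTX orbT.
Qed.

(** * The general case *)

Lemma expg_index_normal (gT : finGroupType) (G N : {group gT}) (x : gT) :
  N <| G -> x \in G -> x ^+ #|G : N| \in N.
Proof.
case/andP=> sNG nNG Gx; have Nx := subsetP nNG x Gx.
apply: coset_idr; first exact: groupX.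
by rewrite morphX // -card_quotient // expg_cardG // mem_quotient.
Qed.

Lemma gamma_star_leq (k : nat) (gT : finGroupType) (G : {group gT})
    (X := gamma_star_comms k.+2 G) (m := #|X|) :
  #|<<X>>| <= m.+1 ^ (m * (m.+1 ^ (m * m) * (m ^ m * m ^ m))).
Proof.
have sXG: X \subset G := gamma_star_comms_sub k.+2 G.
have nXG: G \subset 'N(X) := gamma_star_comms_norm k.+2 G.
pose K := <<X>>%G; have nKG: K <| G := gamma_star_normal k.+2 G.
have sXK: X \subset K := subset_gen X.
have sKG := normal_sub nKG.
have nK'G: K^`(1) <| G by apply: gFnormal_trans.
have nK'X: X \subset 'N(K^`(1)) := subset_trans sXG (normal_norm nK'G).
apply: card_gen_leq => [x y Xx Xy | x Xx].
  by rewrite memJ_norm // (subsetP nXG) // (subsetP sXG).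
have Kx := subsetP sXK x Xx.
set n := #|K : 'Z(K)|.
have len: n <= m ^ m.
  (* Since [X] generates [K], the centre of [K] is the centraliser of [X] in [K]. *)
  by rewrite /n /center cent_gen; apply: index_cent_leq; apply: subset_trans sKG nXG.
have nK'K: K \subset 'N(K^`(1)) := der_norm 1 K.
set a := #|K : K^`(1)|.
have lea: a <= m.+1 ^ (m * m).
  rewrite /a -card_quotient //= quotient_gen //.
  have eqX := gamma_star_comms_quotient k.+2 nK'G; rewrite -/X in eqX.
  rewrite -eqX; have abX: abelian <<gamma_star_comms k.+2 (G / K^`(1))>>.
    by rewrite eqX -quotient_gen // sub_der1_abelian.
  apply: leq_trans (gamma_star_abelian_leq abX) _.
  have leX: #|gamma_star_comms k.+2 (G / K^`(1))| <= m.
    by rewrite eqX leq_morphim.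
  apply: leq_trans (leq_exp2 _ (leX : _ < m.+1)) _.
  by apply: leq_pexp2l; rewrite // leq_mul.
have xK': x ^+ a \in K^`(1) by apply: expg_index_normal; rewrite ?der_normal.
have xK'Z: (x ^+ a) ^+ n \in 'Z(K).
  apply: expg_index_normal; first exact: center_normal.
  exact: subsetP (der_sub 1 K) _ xK'.
have x1: x ^+ (a * (n * n)) = 1.
  by rewrite expgM expgM expg_index_center_der1 // groupX.
have le_x: #[x] <= a * (n * n).
  rewrite dvdn_leq ?order_dvdn ?x1 //.
  by rewrite !muln_gt0 !indexg_gt0.
by rewrite (leq_trans le_x) // !leq_mul.
Qed.

Theorem theorem1p1 :
  exists f : nat -> nat,
    forall (k m : nat) (gT : finGroupType) (G : {group gT}),
      1 <= k -> 0 < m ->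
      #|gamma_star_comms k G| = m ->
      #|gamma_star k G| <= f m.
Proof.
(* The term [m] serves [k = 1], where the commutators are all of [G]. *)
exists (fun m => maxn m (m.+1 ^ (m * (m.+1 ^ (m * m) * (m ^ m * m ^ m))))).
move=> [|[|k]] m gT G // _ _ <-; rewrite leq_max /gamma_star.
  by rewrite genGid leqnn.
by rewrite gamma_star_leq orbT.
Qed.
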